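(* Let $q\in\mathbb{R}$. The nonlinear differential equation $$\frac{dy}{dx}=y^{q}\qquad (y>0)$$ is invariant under the rescaling $$\tilde{y}:=\frac{y}{C_{0}},\qquad \tilde{x}:=\frac{x}{C_{0}^{1-q}}$$ for any positive real number $C_0$. That is, if $I\subseteq\mathbb{R}$ is an open interval, $y:I\to(0,\infty)$ is differentiable, and $\tilde{y}$ is the function on $\tilde I:=\{x/C_0^{1-q}: x\in I\}$ given by $\tilde{y}(\tilde{x})=\frac{1}{C_0}\,y\bigl(C_0^{1-q}\tilde{x}\bigr)$, then $y$ satisfies $\frac{dy}{dx}=y^{q}$ on $I$ if and only if $\tilde y$ satisfies $\frac{d\tilde{y}}{d\tilde{x}}=\tilde{y}^{q}$ on $\tilde I$.
   Context: In the source, the scaling factor $C_0>0$ is attached to a solution with initial condition $(x_0,y_0)$, $y_0>0$, by $\ln_q C_0=\ln_q y_0-x_0$, where $\ln_q y:=\int_1^y v^{-q}\,dv$, and $C_0$ can be taken to be any positive real number. *)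

(* Defs.v *)
From HB Require Import structures.
From mathcomp Require Import all_boot all_order all_algebra.
From mathcomp Require Import all_classical all_reals all_analysis.
Set Implicit Arguments.
Unset Strict Implicit.
Unset Printing Implicit Defensive.
Import Order.TTheory GRing.Theory Num.Theory.
Import numFieldNormedType.Exports.
Local Open Scope classical_set_scope.
Local Open Scope ring_scope.

(* A function on the open set I is represented by a total function R -> R whose
   values outside I are irrelevant: since I is open, neither the values nor the
   two-sided derivatives at points of I depend on them. *)
Definition power_ode_solution (R : realType) (q : R) (I : set R) (y : R -> R) :
    Prop :=
  forall x : R, I x ->
    [/\ 0 < y x, derivable y x 1 & (y^`())%classic x = y x `^ q].

Definition rescaled_domain (R : realType) (q C0 : R) (I : set R) : set R :=
  [set x / C0 `^ (1 - q) | x in I].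

(* Main.v *)
(* By the chain rule, the rescaling multiplies y' by C0^(1-q) / C0 = C0^(-q),
   which is also the factor by which it multiplies y^q. *)
Require Import Defs.
From HB Require Import structures.
From mathcomp Require Import all_boot all_order all_algebra.
From mathcomp Require Import all_classical all_reals all_analysis.
Set Implicit Arguments.
Unset Strict Implicit.
Unset Printing Implicit Defensive.
Import Order.TTheory GRing.Theory Num.Theory.
Import numFieldNormedType.Exports.
Local Open Scope classical_set_scope.
Local Open Scope ring_scope.

(** Put [k = C0^(1-q)]. At [t], both sides of the equation for [yt] equal [C0^-1 * k] times the
    corresponding sides for [y] at [k * t]: the derivative by [is_derive_rescale], the power by
    [powR_rescale]. This factor is nonzero, so the two equations are equivalent point by point, and
    [t |-> k * t] maps the rescaled domain bijectively onto [I]. *)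

Lemma is_derive_rescale (R : realType) (f : R -> R) (a k x df : R) :
  is_derive (k * x) 1 f df ->
  is_derive x 1 (fun t => a * f (k * t)) (a * k * df).
Proof.
move=> fdf.
have kx : is_derive x 1 ( *%R k) k.
  by have := is_deriveZ k (is_derive_id x (1 : R)); rewrite [k *: 1]mulr1.
have := is_deriveZ a (is_derive1_comp fdf kx).
by rewrite [a *: _]mulrA mulrAC.
Qed.

(** The factor [c^(-q)] is written as [c^-1 * c^(1-q)] to match the one produced by the chain rule,
    so that the two cancel. *)
Lemma powR_rescale (R : realType) (q c u : R) : 0 < c -> 0 <= u ->
  (c^-1 * u) `^ q = c^-1 * c `^ (1 - q) * u `^ q.
Proof.
move=> c0 u0; have c_neq0 : c != 0 by rewrite gt_eqF.
have c_ge0 := ltW c0.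
rewrite powRM ?invr_ge0// powRB ?c_neq0 ?implybT// powRr1//.
by rewrite mulKf// -powR_inv1// -powRrM mulN1r powRN.
Qed.

Theorem proposition1 (R : realType) (q C0 : R) (I : set R) (y yt : R -> R)
  (C0_gt0 : 0 < C0)
  (I_open : open I) (I_itv : is_interval I)
  (y_gt0 : forall x : R, I x -> 0 < y x)
  (y_diff : forall x : R, I x -> derivable y x 1)
  (yt_def : forall xt : R, rescaled_domain q C0 I xt ->
     yt xt = C0^-1 * y (C0 `^ (1 - q) * xt)) :
  power_ode_solution q I y <->
  power_ode_solution q (rescaled_domain q C0 I) yt.
Proof.
set k := C0 `^ (1 - q); have k_gt0 : 0 < k by exact: powR_gt0.
have k_neq0 : k != 0 by rewrite gt_eqF.
have domE t : rescaled_domain q C0 I t <-> I (k * t).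
  split=> [[x Ix <-]|Ikt]; first by rewrite -/k mulrC divfK.
  by exists (k * t); rewrite // -/k mulrC mulKf.
have dom_open : open [set t | I (k * t)].
  by apply: open_comp => // t _; exact: mulrl_continuous.
have yt_derive t : I (k * t) ->
    is_derive t 1 yt (C0^-1 * k * y^`()%classic (k * t)).
  move=> Ikt.
  have ykt : is_derive (k * t) 1 y (y^`()%classic (k * t)).
    by rewrite derive1E; apply/derivableP/y_diff.
  (* [yt] is prescribed only on the rescaled domain; since that set is open, [yt] agrees with the
     formula near [t] and has the same derivative there. *)
  apply: near_eq_is_derive (is_derive_rescale C0^-1 ykt).
  by near=> s; apply/esym/yt_def/domE; near: s; exact: open_nbhs_nbhs.
have odeE t : I (k * t) ->
    yt^`()%classic t = yt t `^ q <->
    y^`()%classic (k * t) = y (k * t) `^ q.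
  move=> Ikt; have ytd := yt_derive _ Ikt.
  rewrite derive1E derive_val yt_def; last exact/domE.
  rewrite -/k powR_rescale// ?ltW ?y_gt0//; split=> [|-> //].
  by apply: mulfI; rewrite mulf_neq0 ?invr_eq0 ?gt_eqF.
split=> [ysol t /domE Ikt|ytsol x Ix].
  have ytd := yt_derive _ Ikt; have [_ _ yE] := ysol _ Ikt.
  split; [|exact: ex_derive|exact/odeE].
  by rewrite yt_def ?mulr_gt0 ?invr_gt0 ?y_gt0//; exact/domE.
(* For the converse, [x] in [I] is reached from the point [x / k] of the rescaled domain. *)
have xE : k * (x / k) = x by rewrite mulrC divfK.
have Ikx : I (k * (x / k)) by rewrite xE.
have [_ _ ytE] := ytsol _ ((domE _).2 Ikx).
split; [exact: y_gt0|exact: y_diff|].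
by rewrite -xE; apply/odeE.
Unshelve. all: by end_near.
Qed.
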